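(* Let $n\ge 2$. A nonempty subset $D\subseteq S_n$ is a $2$-design in $(S_n,d_S)$ if and only if $\sum_{j=0}^n j f_j=n-1$ and $\sum_{j=0}^n j^2 f_j=1+(n-1)^2$. In particular, these conditions are satisfied if $|D|=n(n-1)$ and the frequencies of $D$ are $f_1=f_2=\dots=f_{n-2}=0$, $f_{n-1}=\frac{n-2}{n-1}$, $f_n=\frac{1}{n}$.
   Context: $S_n$ is the symmetric group on $n$ letters. For $\nu\in S_n$ let $F(\nu)$ be its number of fixed points; the metric is $d_S(\sigma,\theta)=n-F(\sigma\theta^{-1})$. For $j\in\{0,\dots,n\}$ let $v_j$ be the number of permutations with exactly $n-j$ fixed points. For nonempty $D\subseteq S_n$, its frequencies are $f_i=|\{(x,y)\in D^2: d_S(x,y)=i\}|/|D|^2$, $i=0,\dots,n$. $D$ is a $t$-design if $\sum_{j=0}^n f_j j^i=\sum_{j=0}^n \frac{v_j}{n!} j^i$ for every $i=1,\dots,t$. *)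

(* Defs.v *)
From mathcomp Require Import all_boot all_order all_algebra all_fingroup.

Set Implicit Arguments.
Unset Strict Implicit.
Unset Printing Implicit Defensive.

Import GRing.Theory.
Local Open Scope ring_scope.

Definition nfix (n : nat) (s : 'S_n) : nat := #|[set x : 'I_n | s x == x]|.

(* MathComp composes permutations left to right; the opposite convention
   replaces s * t^-1 by a conjugate, which has as many fixed points.
   The truncated subtraction is exact because nfix u <= n. *)
Definition dS (n : nat) (s t : 'S_n) : nat := (n - nfix (s * t^-1)%g)%N.

(* Meaningful for j <= n, the only range in which it is used. *)
Definition vS (n j : nat) : nat := #|[set s : 'S_n | nfix s == (n - j)%N]|.

Definition freq (n : nat) (D : {set 'S_n}) (i : nat) : rat :=
  #|[set p : 'S_n * 'S_n | [&& p.1 \in D, p.2 \in D & dS p.1 p.2 == i]]|%:R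
  / (#|D| ^ 2)%:R.

Definition is_design (n t : nat) (D : {set 'S_n}) : Prop :=
  forall i : nat, (1 <= i <= t)%N ->
    \sum_(0 <= j < n.+1) freq D j * j%:R ^+ i
    = \sum_(0 <= j < n.+1) ((vS n j)%:R / n`!%:R) * j%:R ^+ i.

(* Main.v *)
Require Import Defs.
From mathcomp Require Import all_boot all_order all_algebra all_fingroup.
From mathcomp Require Import ring zify.

Set Implicit Arguments.
Unset Strict Implicit.
Unset Printing Implicit Defensive.

Import GRing.Theory Num.Theory.
Local Open Scope ring_scope.

(** The right-hand sides of the design equations are the first two moments of
    [n - F(s)] for a uniformly random permutation [s].  Counting pairs [(s, x)]
    and triples [(s, x, y)] with [x], [y] fixed by [s] shows that [F] has first
    moment [1] and second moment [2] as soon as [n >= 2], so these moments are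
    [n - 1] and [n^2 - 2n + 2 = 1 + (n - 1)^2]. *)

(** Fixing [A] pointwise amounts to having support inside [~: A], and [card_perm] counts such
    permutations. *)
Lemma card_perm_fixing (T : finType) (A : {set T}) :
  #|[set s : {perm T} | A \subset [set x | s x == x]]| = (#|T| - #|A|)`!%N.
Proof.
have <- : #|~: A| = (#|T| - #|A|)%N by rewrite cardsCs setCK.
rewrite -card_perm; apply: eq_card => s.
rewrite !inE; apply/subsetP/subsetP => [fixA x | fixA x xA].
  by rewrite !inE; apply: contra => /fixA; rewrite inE.
by rewrite inE; apply: contraTT xA => /fixA; rewrite inE.
Qed.

Lemma nfixE n (s : 'S_n) : nfix s = (\sum_x (s x == x))%N.
Proof. by rewrite /nfix cardsE -sum1_card big_mkcond; apply: eq_bigr. Qed.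

Lemma nfix_le n (s : 'S_n) : (nfix s <= n)%N.
Proof. by rewrite -[leqRHS]card_ord max_card. Qed.

Lemma sum_fix1 n (x : 'I_n) : (\sum_(s : 'S_n) (s x == x))%N = n.-1`!.
Proof.
have := card_perm_fixing [set x]; rewrite cards1 card_ord subn1 => <-.
rewrite -sum1dep_card [RHS]big_mkcond.
by apply: eq_bigr => s _; rewrite sub1set inE; case: eqP.
Qed.

Lemma sum_fix2 n (x y : 'I_n) : x != y ->
  (\sum_(s : 'S_n) (s x == x) * (s y == y))%N = n.-2`!.
Proof.
move=> xy; have := card_perm_fixing [set x; y].
rewrite cards2 xy card_ord subn2 => <-; rewrite -sum1dep_card [RHS]big_mkcond.
by apply: eq_bigr => s _; rewrite subUset !sub1set !inE; do 2 case: eqP.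
Qed.

Lemma sum_nfix n : (0 < n)%N -> (\sum_(s : 'S_n) nfix s)%N = n`!.
Proof.
case: n => // n _; under eq_bigr do rewrite nfixE.
rewrite exchange_big /=; under eq_bigr do rewrite sum_fix1.
by rewrite sum_nat_const card_ord factS.
Qed.

Lemma sum_nfix_sqr n : (1 < n)%N -> (\sum_(s : 'S_n) nfix s ^ 2)%N = (2 * n`!)%N.
Proof.
case: n => [|[|n]] // _.
under eq_bigr => s _ do rewrite nfixE -mulnn big_distrlr /=.
rewrite exchange_big /=.
have inner (x : 'I_n.+2) :
  (\sum_(s : 'S_n.+2) \sum_y (s x == x) * (s y == y))%N = (2 * n.+1`!)%N.
  rewrite exchange_big (bigD1 x) //=.
  under eq_bigr do rewrite mulnb andbb.
  under [X in (_ + X)%N]eq_bigr => y yx do rewrite sum_fix2 1?eq_sym //=.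
  rewrite sum_fix1 sum_nat_const cardC1 card_ord /= factS mul2n -addnn; lia.
under eq_bigr do rewrite inner.
by rewrite sum_nat_const card_ord [in RHS]factS mulnCA.
Qed.

(** Group the permutations by [n - nfix s]: the class of [j] has [vS n j] elements. This turns the
    design sums into moments of [nfix]. *)
Lemma sum_vS (R : nzRingType) n (g : nat -> R) :
  \sum_(0 <= j < n.+1) (vS n j)%:R * g j = \sum_(s : 'S_n) g (n - nfix s)%N.
Proof.
rewrite big_mkord.
(* Since [n - nfix s] is at most [n], [inord] never falls back on its default value. *)
rewrite (partition_big (fun s : 'S_n => inord (n - nfix s) : 'I_n.+1) predT) //=.
apply: eq_bigr => j _; have jn : (j <= n)%N by rewrite -ltnS.
have key (s : 'S_n) : (inord (n - nfix s) == j :> 'I_n.+1) = (nfix s == n - j)%N.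
  rewrite -val_eqE /= inordK ?ltnS ?leq_subr //.
  by apply/eqP/eqP => [<-|->]; rewrite subKn // nfix_le.
rewrite (eq_bigr (fun=> g j)); last first.
  by move=> s; rewrite key => /eqP->; rewrite subKn.
rewrite (eq_bigl _ _ key) sumr_const mulr_natl /vS; congr (_ *+ _).
by apply: eq_card => s; rewrite !inE.
Qed.

Lemma mean_vS n : (0 < n)%N ->
  \sum_(0 <= j < n.+1) ((vS n j)%:R / n`!%:R) * j%:R ^+ 1 = n%:R - 1 :> rat.
Proof.
move=> n_gt0; have fact_neq0 : n`!%:R != 0 :> rat.
  by rewrite pnatr_eq0 -lt0n fact_gt0.
under eq_bigr do rewrite mulrAC.
rewrite -mulr_suml (sum_vS _ (fun j => j%:R ^+ 1)).
under eq_bigr do rewrite expr1 natrB ?nfix_le //.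
rewrite sumrB sumr_const card_Sn -natr_sum sum_nfix // -mulr_natl.
by field.
Qed.

Lemma mean_sqr_vS n : (1 < n)%N ->
  \sum_(0 <= j < n.+1) ((vS n j)%:R / n`!%:R) * j%:R ^+ 2
  = 1 + (n%:R - 1) ^+ 2 :> rat.
Proof.
move=> n_gt1; have fact_neq0 : n`!%:R != 0 :> rat.
  by rewrite pnatr_eq0 -lt0n fact_gt0.
under eq_bigr do rewrite mulrAC.
rewrite -mulr_suml (sum_vS _ (fun j => j%:R ^+ 2)).
under eq_bigr do rewrite natrB ?nfix_le // sqrrB -natrX -mulrnAr -natrX.
rewrite big_split sumrB /= -mulr_sumr sumr_const card_Sn sumrMnl -!natr_sum.
rewrite sum_nfix ?(ltnW n_gt1) // sum_nfix_sqr //.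
by rewrite -mulr_natl -(mulr_natl _ 2) natrM natrX; field.
Qed.

Lemma sum_last_two (R : nzRingType) m (g : nat -> R) :
  (forall j, (j <= m)%N -> g j = 0) ->
  \sum_(0 <= j < m.+3) g j = g m.+1 + g m.+2.
Proof.
move=> g0; rewrite 2?big_nat_recr //= big_nat_cond big1 ?add0r // => j.
by rewrite andbT ltnS => /g0.
Qed.

Theorem theorem4 (n : nat) (hn : (2 <= n)%N) (D : {set 'S_n}) (hD : D != set0) :
  (is_design 2 D <->
     (\sum_(0 <= j < n.+1) j%:R * freq D j = n%:R - 1 /\
      \sum_(0 <= j < n.+1) j%:R ^+ 2 * freq D j = 1 + (n%:R - 1) ^+ 2)) /\
  (#|D| = (n * (n - 1))%N ->
   (forall i : nat, (1 <= i <= n - 2)%N -> freq D i = 0) ->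
   freq D (n - 1)%N = (n%:R - 2) / (n%:R - 1) ->
   freq D n = 1 / n%:R ->
     (\sum_(0 <= j < n.+1) j%:R * freq D j = n%:R - 1 /\
      \sum_(0 <= j < n.+1) j%:R ^+ 2 * freq D j = 1 + (n%:R - 1) ^+ 2)).
Proof.
split.
  have comm i : \sum_(0 <= j < n.+1) j%:R ^+ i * freq D j
              = \sum_(0 <= j < n.+1) freq D j * j%:R ^+ i.
    by apply: eq_bigr => j _; rewrite mulrC.
  (* [comm 1] applies because [x ^+ 1] is convertible to [x]. The second moment is rewritten first,
     as its value contains [n%:R - 1], the value of the mean. *)
  rewrite (comm 1%N) (comm 2%N) -(mean_sqr_vS hn) -(mean_vS (ltnW hn)).
  split=> [design | [eq1 eq2] [|[|[|i]]] //].
  by split; apply: design.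
case: n hn D hD => [|[|m]] // _ D _ _.
rewrite subn1 subn2 /= => f0 f_pred f_last.
have nat_neq0 k : k.+1%:R != 0 :> rat by rewrite pnatr_eq0.
have m1E : m.+2%:R - 1 = m.+1%:R :> rat by rewrite -natr1 addrK.
have m2E : m.+2%:R - 2 = m%:R :> rat by rewrite -!natr1; ring.
rewrite m1E m2E in f_pred *.
(* Here [n = m.+2]. Nothing is assumed about [freq D 0]; at [j = 0] it is the factor [j%:R] that
   vanishes. *)
have f_small j : (j <= m)%N -> j%:R * freq D j = 0.
  by case: j => [|j] jm; rewrite ?mul0r // f0 ?mulr0.
have f_small2 j : (j <= m)%N -> j%:R ^+ 2 * freq D j = 0.
  by move=> /f_small fj; rewrite expr2 -mulrA fj mulr0.
rewrite (sum_last_two f_small) (sum_last_two f_small2) f_pred f_last.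
(* What remains is [(n - 2) + 1 = n - 1] and [(n - 1)(n - 2) + n = 1 + (n - 1)^2], once the nonzero
   denominators [n - 1] and [n] are cleared. *)
have := nat_neq0 m; have := nat_neq0 m.+1.
by rewrite -!natr1 => nz2 nz1; split; field; rewrite ?nz1 ?nz2.
Qed.
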